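(* Assume that $q$ is not a root of unity. Then the $\mathbb F$-algebra $Z(\hat H_q)$ (the center of $\hat H_q$) is generated by $T_0,T_1,T_2,T_3$.
   Context: Algebras are associative with multiplicative identity $1$. $\mathbb F$ is a field and $q\in\mathbb F$ is nonzero with $q^4\neq 1$. The universal DAHA of type $(C_1^\vee,C_1)$, denoted $\hat H_q$, is the $\mathbb F$-algebra defined by generators $t_i^{\pm1}$ ($i\in\{0,1,2,3\}$) and relations: (i) $t_it_i^{-1}=t_i^{-1}t_i=1$ for each $i$; (ii) $t_i+t_i^{-1}$ is central for each $i$; (iii) $t_0t_1t_2t_3=q^{-1}$. Define $T_i=t_i+t_i^{-1}\in\hat H_q$ for $i\in\{0,1,2,3\}$. *)

(* Defs.v *)
From HB Require Import structures.
From mathcomp Require Import all_boot all_order all_algebra.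
From mathcomp Require Import generic_quotient ring_quotient.
From mathcomp Require Import boolp classical_sets.
From mathcomp Require Import finmap monalg.

Set Implicit Arguments.
Unset Strict Implicit.
Unset Printing Implicit Defensive.

Import GRing.Theory.
Local Open Scope classical_set_scope.
Local Open Scope ring_scope.
Local Open Scope quotient_scope.

Definition ring_center (A : nzRingType) : set A :=
  [set z | forall x : A, GRing.comm z x].

Definition subalg_gen (F : fieldType) (A : algType F) (S : set A) : set A :=
  smallest [set B : set A | GRing.subalg_closed (mem B)] S.

Definition ideal_closed (A : nzRingType) (J : set A) : Prop :=
  [/\ J 0, forall x y, J x -> J y -> J (x - y)
    & forall a x b, J x -> J (a * x * b)].

Definition ideal_gen (A : nzRingType) (S : set A) : set A :=
  smallest (@ideal_closed A) S.

Lemma ideal_gen_closed (A : nzRingType) (S : set A) :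
  ideal_closed (ideal_gen S).
Proof.
split=> [J [[]]//|x y Jx Jy J JS|a x b Jx J JS]; have [[? JB JM] ?] := JS.
  by apply: JB; [exact: Jx | exact: Jy].
by apply: JM; exact: Jx.
Qed.

Record properIdeal (A : nzRingType) := ProperIdeal {
  ideal_set : set A;
  ideal_setP : ideal_closed ideal_set;
  ideal_set1 : ~ ideal_set 1 }.

(* MathComp quotients a ring by an ideal only in the commutative case; the
   ring and algebra structures on the additive quotient are built here. *)
Section QuotientAlgebra.
Variables (F : fieldType) (A : algType F) (I : properIdeal A).

Local Notation J := (ideal_set I).

Definition ideal_pred : {pred A} := fun x => `[< J x >].

Fact ideal_pred_zmod_closed : zmod_closed ideal_pred.
Proof.
have [J0 JB _] := ideal_setP I.
by split=> [|x y /asboolP Jx /asboolP Jy]; apply/asboolP => //; apply: JB.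
Qed.

HB.instance Definition _ :=
  GRing.isZmodClosed.Build A ideal_pred ideal_pred_zmod_closed.

Let ideal_zmod : zmodClosed A := ideal_pred.

Definition quotAlg : Type := Quotient.quot ideal_zmod.

HB.instance Definition _ := GRing.Zmodule.on quotAlg.
HB.instance Definition _ := EqQuotient.on quotAlg.

Definition quotAlg_pi (x : A) : quotAlg := \pi_quotAlg x.
Local Notation piQ := quotAlg_pi.

Lemma quotAlg_pi_surj (u : quotAlg) : exists x, u = piQ x.
Proof. by exists (repr u); rewrite /quotAlg_pi reprK. Qed.

Lemma quotAlg_eqP (x y : A) : reflect (piQ x = piQ y) `[< J (x - y) >].
Proof.
apply: (iffP idP) => [Jxy|/eqP xy].
  by apply/eqP; rewrite -(Quotient.idealrBE ideal_zmod).
by move: xy; rewrite -(Quotient.idealrBE ideal_zmod).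
Qed.

Definition mulQ (u v : quotAlg) : quotAlg := locked (piQ (repr u * repr v)).
Definition scaleQ (c : F) (u : quotAlg) : quotAlg := locked (piQ (c *: repr u)).

Let idealM (a x b : A) : J x -> J (a * x * b).
Proof. by have [_ _ JM] := ideal_setP I; exact: JM. Qed.

Let idealB (x y : A) : J x -> J y -> J (x - y).
Proof. by have [_ JB _] := ideal_setP I; exact: JB. Qed.

Let idealD (x y : A) : J x -> J y -> J (x + y).
Proof.
move=> Jx Jy; have [J0 _ _] := ideal_setP I.
by rewrite -[y]opprK -[- y]add0r; apply: idealB => //; apply: idealB.
Qed.

Let idealZ (c : F) (x : A) : J x -> J (c *: x).
Proof.
by move=> Jx; rewrite -[c *: x]mulr1 -[x]mul1r scalerAl; exact: idealM.
Qed.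

Let reprQ (x : A) : J (repr (piQ x) - x).
Proof. by apply/asboolP/quotAlg_eqP; rewrite /quotAlg_pi reprK. Qed.

Fact pi_quotAlgM (x y : A) : piQ (x * y) = mulQ (piQ x) (piQ y).
Proof.
rewrite /mulQ -lock; apply/esym/quotAlg_eqP/asboolP.
set x' := repr _; set y' := repr _.
have -> : x' * y' - x * y = 1 * (x' - x) * y' + x * (y' - y) * 1.
  by rewrite mul1r mulr1 mulrBl mulrBr addrA subrK.
by apply: idealD; apply: idealM; exact: reprQ.
Qed.

Fact pi_quotAlgZ (c : F) (x : A) : piQ (c *: x) = scaleQ c (piQ x).
Proof.
rewrite /scaleQ -lock; apply/esym/quotAlg_eqP/asboolP.
by rewrite -scalerBr; apply: idealZ; exact: reprQ.
Qed.

Let piD (x y : A) : piQ (x + y) = piQ x + piQ y.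
Proof. exact: (raddfD (\pi_quotAlg : A -> Quotient.quot ideal_zmod)). Qed.

Fact mulQA : associative mulQ.
Proof.
move=> u v w; case: (quotAlg_pi_surj u) => x ->.
case: (quotAlg_pi_surj v) => y ->; case: (quotAlg_pi_surj w) => z ->.
by rewrite -!pi_quotAlgM mulrA.
Qed.

Fact mul1Q : left_id (piQ 1) mulQ.
Proof. by move=> u; case: (quotAlg_pi_surj u) => x ->; rewrite -pi_quotAlgM mul1r. Qed.

Fact mulQ1 : right_id (piQ 1) mulQ.
Proof. by move=> u; case: (quotAlg_pi_surj u) => x ->; rewrite -pi_quotAlgM mulr1. Qed.

Fact mulQDl : left_distributive mulQ +%R.
Proof.
move=> u v w; case: (quotAlg_pi_surj u) => x ->.
case: (quotAlg_pi_surj v) => y ->; case: (quotAlg_pi_surj w) => z ->.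
by rewrite -piD -!pi_quotAlgM mulrDl piD.
Qed.

Fact mulQDr : right_distributive mulQ +%R.
Proof.
move=> u v w; case: (quotAlg_pi_surj u) => x ->.
case: (quotAlg_pi_surj v) => y ->; case: (quotAlg_pi_surj w) => z ->.
by rewrite -piD -!pi_quotAlgM mulrDr piD.
Qed.

Fact oneQ_neq0 : piQ 1 != 0.
Proof.
apply/eqP => pi1; apply: (ideal_set1 (p := I)).
have pi0 : piQ 0 = 0 by exact: (raddf0 (\pi_quotAlg : A -> Quotient.quot ideal_zmod)).
by rewrite -[1]subr0; apply/asboolP/quotAlg_eqP; rewrite pi1 pi0.
Qed.

HB.instance Definition _ := GRing.Zmodule_isNzRing.Build quotAlg
  mulQA mul1Q mulQ1 mulQDl mulQDr oneQ_neq0.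

Fact scaleQA (a b : F) (u : quotAlg) : scaleQ a (scaleQ b u) = scaleQ (a * b) u.
Proof. by case: (quotAlg_pi_surj u) => x ->; rewrite -!pi_quotAlgZ scalerA. Qed.

Fact scale1Q : left_id 1 scaleQ.
Proof. by move=> u; case: (quotAlg_pi_surj u) => x ->; rewrite -pi_quotAlgZ scale1r. Qed.

Fact scaleQDr : right_distributive scaleQ +%R.
Proof.
move=> a u v; case: (quotAlg_pi_surj u) => x ->; case: (quotAlg_pi_surj v) => y ->.
by rewrite -piD -!pi_quotAlgZ scalerDr piD.
Qed.

Fact scaleQDl (u : quotAlg) : {morph scaleQ^~ u : a b / a + b}.
Proof.
by move=> a b; case: (quotAlg_pi_surj u) => x ->; rewrite -!pi_quotAlgZ scalerDl piD.
Qed.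

HB.instance Definition _ := GRing.Zmodule_isLmodule.Build F quotAlg
  scaleQA scale1Q scaleQDr scaleQDl.

Fact scaleQAl (a : F) (u v : quotAlg) : a *: (u * v) = a *: u * v.
Proof.
case: (quotAlg_pi_surj u) => x ->; case: (quotAlg_pi_surj v) => y ->.
rewrite /GRing.scale /GRing.mul /=.
by rewrite -!(pi_quotAlgZ, pi_quotAlgM) scalerAl.
Qed.

HB.instance Definition _ := GRing.Lmodule_isLalgebra.Build F quotAlg scaleQAl.

Fact scaleQAr (a : F) (u v : quotAlg) : a *: (u * v) = u * (a *: v).
Proof.
case: (quotAlg_pi_surj u) => x ->; case: (quotAlg_pi_surj v) => y ->.
rewrite /GRing.scale /GRing.mul /=.
by rewrite -!(pi_quotAlgZ, pi_quotAlgM) scalerAr.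
Qed.

HB.instance Definition _ := GRing.Lalgebra_isAlgebra.Build F quotAlg scaleQAr.

Fact quotAlg_pi_zmod_morphism : zmod_morphism quotAlg_pi.
Proof. exact: (raddfB (\pi_quotAlg : A -> Quotient.quot ideal_zmod)). Qed.

Fact quotAlg_pi_monoid_morphism : monoid_morphism quotAlg_pi.
Proof. by split=> // x y; exact: pi_quotAlgM. Qed.

Fact quotAlg_pi_scalable : scalable quotAlg_pi.
Proof. by move=> c x; exact: pi_quotAlgZ. Qed.

HB.instance Definition _ :=
  GRing.isZmodMorphism.Build A quotAlg quotAlg_pi quotAlg_pi_zmod_morphism.
HB.instance Definition _ :=
  GRing.isMonoidMorphism.Build A quotAlg quotAlg_pi quotAlg_pi_monoid_morphism.
HB.instance Definition _ :=
  GRing.isScalable.Build F A quotAlg *:%R quotAlg_pi quotAlg_pi_scalable.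

End QuotientAlgebra.

Fact malg_scalerAr (K : monomType) (R : comNzRingType) (c : R)
  (x y : {malg R[K]}) : c *: (x * y) = x * (c *: y).
Proof.
apply/malgP=> k; rewrite [LHS]mcoeffZ mcoeffMl mulr_sumr.
rewrite [RHS](mcoeffMlw _ (fsubset_refl (msupp x)) (msuppZ_le c y)).
apply: eq_bigr => k1 _; rewrite mulr_sumr; apply: eq_bigr => k2 _.
by rewrite mcoeffZ mulrnAr mulrCA.
Qed.

Section FreeAlgebra.
Variables (F : fieldType) (I : choiceType).

Definition free_malg : Type := {malg F[{fmonom I}]}.

HB.instance Definition _ := GRing.Lalgebra.on free_malg.
HB.instance Definition _ :=
  GRing.Lalgebra_isAlgebra.Build F free_malg
    (@malg_scalerAr {fmonom I} F).

Definition freeAlg : algType F := free_malg.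

Definition freeAlg_gen (i : I) : freeAlg := (<< fmu i >> : {malg F[{fmonom I}]}).

Section CommutativeEvaluation.
Variable v : I -> F.

Definition fmonom_eval (m : {fmonom I}) : F := \prod_(i <- m : seq I) v i.

Fact fmonom_eval_mmorphism : mmorphism fmonom_eval.
Proof.
split=> [m1 m2|]; rewrite /fmonom_eval; first by rewrite fmM big_cat.
by rewrite fm1 big_nil.
Qed.

HB.instance Definition _ :=
  isMultiplicative.Build {fmonom I} F fmonom_eval fmonom_eval_mmorphism.

Lemma freeAlg_eval_ex : exists ev : freeAlg -> F,
  [/\ {morph ev : a b / a - b}, {morph ev : a b / a * b}, ev 1 = 1,
      forall c a, ev (c *: a) = c * ev a
    & forall i, ev (freeAlg_gen i) = v i].
Proof.
pose ev : {malg F[{fmonom I}]} -> F := mmap idfun fmonom_eval.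
exists ev; split; rewrite {}/ev.
- exact: rmorphB.
- exact: rmorphM.
- exact: rmorph1.
- exact: mmapZ.
by move=> i; rewrite [LHS]mmapU mul1r /= /fmonom_eval fmU big_seq1.
Qed.

End CommutativeEvaluation.

End FreeAlgebra.

(* x and y are the letters standing for the t_i and their inverses. *)
Definition daha_relators (F : fieldType) (q : F) (A : algType F)
    (x y : 'I_4 -> A) : set A :=
  [set r | exists i, r = x i * y i - 1] `|`
  [set r | exists i, r = y i * x i - 1] `|`
  [set r | exists i a, r = (x i + y i) * a - a * (x i + y i)] `|`
  [set x 0 * x 1 * x 2 * x 3 - q^-1%:A].

Lemma daha_ideal_proper_of (F : fieldType) (q : F) (A : algType F)
    (x y : 'I_4 -> A) (ev : A -> F) : q != 0 ->
    {morph ev : a b / a - b} -> {morph ev : a b / a * b} -> ev 1 = 1 ->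
    (forall c a, ev (c *: a) = c * ev a) ->
    (forall i, ev (x i) = if i == 0 then q^-1 else 1) ->
    (forall i, ev (y i) = if i == 0 then q else 1) ->
  ~ ideal_gen (daha_relators q x y) 1.
Proof.
move=> hq evB evM ev1 evZ evx evy H.
suff: [set a | ev a = 0] 1 by move/eqP; rewrite ev1 oner_eq0.
apply: H; split; first split.
- by rewrite /mkset -(subrr 1) evB subrr.
- by move=> a b ea eb; rewrite /mkset evB ea eb subrr.
- by move=> a b c eb; rewrite /mkset !evM eb mulr0 mul0r.
move=> r [[[[i ->]|[i ->]]|[i [a ->]]]|->]; rewrite /mkset evB.
- by rewrite evM ev1 evx evy; case: eqP => _; rewrite ?mulVf ?mulr1 ?subrr.
- by rewrite evM ev1 evx evy; case: eqP => _; rewrite ?mulfV ?mulr1 ?subrr.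
- by rewrite !evM mulrC subrr.
by rewrite !evM evZ ev1 !evx /= !mulr1 subrr.
Qed.

Section QuotientRelations.
Variables (F : fieldType) (q : F) (A : algType F) (x y : 'I_4 -> A).
Variables (I : properIdeal A).
Hypothesis IE : ideal_set I = ideal_gen (daha_relators q x y).
Local Notation pi := (quotAlg_pi I).

Let pi_eq (a b : A) : daha_relators q x y (a - b) -> pi a = pi b.
Proof.
by move=> Sab; apply/quotAlg_eqP/asboolP; rewrite IE => J [_]; exact.
Qed.

Lemma quot_tV i : pi (x i) * pi (y i) = 1.
Proof. by rewrite -rmorphM -(rmorph1 pi); apply: pi_eq; do 3!left; exists i. Qed.

Lemma quot_Vt i : pi (y i) * pi (x i) = 1.
Proof.
by rewrite -rmorphM -(rmorph1 pi); apply: pi_eq; left; left; right; exists i.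
Qed.

Lemma quot_T_central i : ring_center (pi (x i) + pi (y i)).
Proof.
move=> u; have [a ->] := quotAlg_pi_surj u.
rewrite /GRing.comm -rmorphD -!rmorphM.
by apply: pi_eq; left; right; exists i, a.
Qed.

Lemma quot_t_prod : pi (x 0) * pi (x 1) * pi (x 2) * pi (x 3) = q^-1%:A.
Proof.
rewrite -!rmorphM -(rmorph1 pi) -[RHS]quotAlg_pi_scalable.
by apply: pi_eq; right.
Qed.

End QuotientRelations.

Section UniversalDAHA.
Variables (F : fieldType) (q : F).

(* The letter (i, false) stands for t_i and (i, true) for its inverse. *)
Definition daha_free : algType F := freeAlg F ('I_4 * bool)%type.
Definition daha_x (i : 'I_4) : daha_free := freeAlg_gen F (i, false).
Definition daha_y (i : 'I_4) : daha_free := freeAlg_gen F (i, true).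

Hypothesis hq : q != 0.

Fact daha_ideal_proper : ~ ideal_gen (daha_relators q daha_x daha_y) 1.
Proof.
have [ev [evB evM ev1 evZ evg]] := freeAlg_eval_ex (fun j : 'I_4 * bool =>
  if j.1 == 0 then if j.2 then q else q^-1 else 1).
apply: (daha_ideal_proper_of (ev := ev)) => // i; first exact: (evg (i, false)).
exact: (evg (i, true)).
Qed.

Definition daha_ideal : properIdeal daha_free :=
  ProperIdeal (ideal_gen_closed _) daha_ideal_proper.

Definition daha : algType F := quotAlg daha_ideal.

Definition daha_t (i : 'I_4) : daha := quotAlg_pi daha_ideal (daha_x i).
Definition daha_tinv (i : 'I_4) : daha := quotAlg_pi daha_ideal (daha_y i).
Definition daha_T (i : 'I_4) : daha := daha_t i + daha_tinv i.

Lemma daha_tV (i : 'I_4) : daha_t i * daha_tinv i = 1.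
Proof. exact: (@quot_tV F q daha_free daha_x daha_y daha_ideal erefl i). Qed.

Lemma daha_Vt (i : 'I_4) : daha_tinv i * daha_t i = 1.
Proof. exact: (@quot_Vt F q daha_free daha_x daha_y daha_ideal erefl i). Qed.

Lemma daha_T_central (i : 'I_4) : ring_center (daha_T i).
Proof. exact: (@quot_T_central F q daha_free daha_x daha_y daha_ideal erefl i). Qed.

Lemma daha_t_prod : daha_t 0 * daha_t 1 * daha_t 2 * daha_t 3 = q^-1%:A.
Proof. exact: (@quot_t_prod F q daha_free daha_x daha_y daha_ideal erefl). Qed.

End UniversalDAHA.

(* Main.v *)
Require Import Defs.
From HB Require Import structures.
From mathcomp Require Import all_boot all_order all_algebra.
From mathcomp Require Import boolp classical_sets.
From mathcomp Require Import finmap monalg ring zify.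

Set Implicit Arguments.
Unset Strict Implicit.
Unset Printing Implicit Defensive.

Import GRing.Theory.

Local Open Scope classical_set_scope.
Local Open Scope ring_scope.

(** Write X = t_0 t_1, b = t_1, a = t_2 and let L be the commutative subalgebra
    generated by the central elements T_i and by X, X^-1. Conjugation by the
    two letters a and b acts on X like the two reflections of an infinite
    dihedral group, up to corrections of lower order: centrality of T_0 and T_3
    says that b X^-1 = X b + T_0 - T_1 X and
    a X^-1 = q^2 X a + T_2 X^-1 - q T_3. Together with the quadratic relations
    g^2 = T g - 1 for g = a, b this rewrites every element as a combination,
    with coefficients in L, of the alternating words 1, a, b, ab, ba, ...
    ([all_spanned]).

    To compare coefficients one needs a representation in which nothing
    collapses ([generic_representation]). Take as operators on functions on a
    bi-infinite chain of nodes: X multiplies by a coordinate pt, while b and a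
    act by 2 x 2 blocks on the pairs of neighbours of the two matchings that
    make up the chain. The product of the coordinates is 1 on each pair for b
    and q^-2 on each pair for a. The requirement that t_0 = X b^-1 and
    t_3 = q^-1 a^-1 X^-1 also have prescribed traces fixes the diagonal of each
    block by a 2 x 2 linear system; the off-diagonal entries only matter
    through their product, so those pointing up the chain can be taken to be 1.
    The parameters T_i and the coordinate of one node are taken to be
    independent indeterminates in a field of rational functions.

    Let z be central. Since z commutes with X, whose coordinates are pairwise
    distinct because q is not a root of unity, z acts diagonally. An
    alternating word of length l moves a node at most l steps up, and from a
    node of the right parity exactly one word of length l moves it l steps up,
    with coefficient 1. Hence the coefficients of the longest words in z vanish
    at a generic node, so they are 0, and by descent z lies in L
    ([central_laurent]). Finally z commutes with a and b, so its diagonal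
    entries agree along the chain; as two steps multiply the coordinate by
    q^-2, the Laurent polynomial z is invariant under X -> q^-2 X, hence
    constant in X, that is, a polynomial in the T_i ([center_parameters]). *)

(** * The ring of linear operators on functions *)

Section LinearOperators.
Variables (I : Type) (i0 : I) (K : fieldType).

Record linop := LinOp {
  op_fun :> (I -> K) -> (I -> K);
  op_linear : forall c f g,
    op_fun (fun i => c * f i + g i) = (fun i => c * op_fun f i + op_fun g i) }.

Lemma linop_eq (A B : linop) : (forall f i, A f i = B f i) -> A = B.
Proof.
case: A B => [A hA] [B hB] /= AB.
have {}AB : A = B by apply/funext => f; apply/funext => i; exact: AB.
by case: B / AB hB => hB; congr LinOp; exact: Prop_irrelevance.
Qed.

HB.instance Definition _ := gen_eqMixin linop.
HB.instance Definition _ := gen_choiceMixin linop.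

Definition diag_op (d : I -> K) : linop.
Proof.
exists (fun f i => d i * f i).
by move=> c f g; apply/funext => i; ring.
Defined.

Definition add_op (A B : linop) : linop.
Proof.
exists (fun f i => A f i + B f i).
by move=> c f g; apply/funext => i; rewrite !op_linear; ring.
Defined.

Definition opp_op (A : linop) : linop.
Proof.
exists (fun f i => - A f i).
by move=> c f g; apply/funext => i; rewrite !op_linear; ring.
Defined.

Definition comp_op (A B : linop) : linop.
Proof.
exists (fun f => A (B f)).
by move=> c f g; rewrite !op_linear.
Defined.

Lemma linopD (A : linop) f g i : A (fun j => f j + g j) i = A f i + A g i.
Proof.
have /(congr1 (fun h => h i)) := op_linear A 1 f g.
rewrite mul1r => <-; congr (A _ i).
by apply/funext => j; rewrite mul1r.
Qed.

Lemma linopZ (A : linop) c f i : A (fun j => c * f j) i = c * A f i.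
Proof.
have A0 : A (fun=> 0) i = 0.
  apply: (addrI (A (fun=> 0) i)); rewrite addr0 -linopD; congr (A _ i).
  by apply/funext => j; rewrite addr0.
have /(congr1 (fun h => h i)) := op_linear A c f (fun=> 0).
rewrite A0 addr0 => <-; congr (A _ i).
by apply/funext => j; rewrite addr0.
Qed.

Fact add_opA : associative add_op.
Proof. by move=> A B C; apply: linop_eq => f i /=; rewrite addrA. Qed.
Fact add_opC : commutative add_op.
Proof. by move=> A B; apply: linop_eq => f i /=; rewrite addrC. Qed.
Fact add_0op : left_id (diag_op (fun=> 0)) add_op.
Proof. by move=> A; apply: linop_eq => f i /=; rewrite mul0r add0r. Qed.
Fact add_Nop : left_inverse (diag_op (fun=> 0)) opp_op add_op.
Proof. by move=> A; apply: linop_eq => f i /=; rewrite mul0r addNr. Qed.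

HB.instance Definition _ :=
  GRing.isZmodule.Build linop add_opA add_opC add_0op add_Nop.

Fact comp_opA : associative comp_op.
Proof. by move=> A B C; apply: linop_eq. Qed.
Fact comp_1op : left_id (diag_op (fun=> 1)) comp_op.
Proof. by move=> A; apply: linop_eq => f i /=; rewrite mul1r. Qed.
Fact comp_op1 : right_id (diag_op (fun=> 1)) comp_op.
Proof. by move=> A; apply: linop_eq => f i /=; rewrite linopZ mul1r. Qed.
Fact comp_opDl : left_distributive comp_op +%R.
Proof. by move=> A B C; apply: linop_eq. Qed.
Fact comp_opDr : right_distributive comp_op +%R.
Proof. by move=> A B C; apply: linop_eq => f i /=; rewrite -linopD. Qed.

End LinearOperators.

(** The index [i0] witnesses that the ring of operators is nonzero; it is a
    parameter of the type so that the ring structure can be inferred from it. *)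
Definition oper (I : Type) (i0 : I) (K : fieldType) : Type := linop I K.

Section OperatorRing.
Variables (I : Type) (i0 : I) (K : fieldType).

HB.instance Definition _ := GRing.Zmodule.on (oper i0 K).

Fact diag_op1_neq0 : (diag_op (fun=> 1) : oper i0 K) != 0.
Proof.
apply/eqP => /(congr1 (fun A : linop I K => A (fun=> 1) i0)) /=.
by rewrite mul0r mul1r; apply/eqP; rewrite oner_eq0.
Qed.

HB.instance Definition _ := GRing.Zmodule_isNzRing.Build (oper i0 K)
  (@comp_opA I K) (@comp_1op I K) (@comp_op1 I K) (@comp_opDl I K)
  (@comp_opDr I K) diag_op1_neq0.

Definition diag (d : I -> K) : oper i0 K := diag_op d.

Lemma operD (A B : oper i0 K) f i : (A + B) f i = A f i + B f i.
Proof. by []. Qed.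

Lemma operM (A B : oper i0 K) f : (A * B) f = A (B f).
Proof. by []. Qed.

Lemma oper1 f i : (1 : oper i0 K) f i = f i.
Proof. by rewrite -[LHS]/(1 * f i) mul1r. Qed.

Lemma operE (A B : oper i0 K) : (forall f i, A f i = B f i) -> A = B.
Proof. exact: linop_eq. Qed.

Lemma diag_zmod_morphism : zmod_morphism (fun c : K => diag (fun=> c)).
Proof. by move=> c d; apply: operE => f i; rewrite /= mulrBl. Qed.

Lemma diag_monoid_morphism : monoid_morphism (fun c : K => diag (fun=> c)).
Proof. by split=> [|c d]; apply: operE => f i //=; rewrite mulrA. Qed.

Definition scal (c : K) : oper i0 K := diag (fun=> c).
HB.instance Definition _ :=
  GRing.isZmodMorphism.Build K (oper i0 K) scal diag_zmod_morphism.
HB.instance Definition _ :=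
  GRing.isMonoidMorphism.Build K (oper i0 K) scal diag_monoid_morphism.

Lemma scal_central c (A : oper i0 K) : GRing.comm (scal c) A.
Proof. by apply: operE => f i; rewrite /= linopZ. Qed.

End OperatorRing.

Arguments diag {I i0 K} d.
Arguments scal {I i0 K} c.


(** * Generation and universal property of the universal DAHA *)

Section UniversalProperty.
Variables (F : fieldType) (q : F) (hq : q != 0).

Local Notation free := (daha_free F).
Local Notation pi := (quotAlg_pi (daha_ideal hq)).

Local Notation letter := ('I_4 * bool)%type.
Local Notation word m := (<< FMonom m >> : {malg F[{fmonom letter}]}).

Let word_cons j m : word (j :: m) = (freeAlg_gen F j : free) * word m.
Proof.
apply/esym/(etrans (fgmulUU _ _ _ _)); rewrite mulr1; congr << _ *g _ >>.
by apply: val_inj; rewrite /= fmM fmU.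
Qed.

Let word_nil : word [::] = 1 :> free.
Proof.
suff -> : FMonom [::] = mone :> {fmonom letter} by [].
by apply: val_inj; rewrite /= fm1.
Qed.

Let word_sum (p : free) :
  p = \sum_(m <- msupp (p : {malg F[{fmonom letter}]})) p@_m *: (<< m >> : free).
Proof.
rewrite {1}[p]monalgE; apply: eq_bigr => m _.
apply/malgP => k; apply: (etrans (mcoeffU _ _ _)).
apply/esym/(etrans (mcoeffZ _ _ _)); rewrite mcoeffU.
by case: (m == k); [exact: mulr1 | exact: mulr0].
Qed.

(** The algebra is spanned by words in the letters t_i and their inverses, so a
    linear subspace that contains 1 and is stable under left multiplication by
    letters is everything. *)
Lemma daha_ind (B : set (daha hq)) :
    B 1 -> (forall u v, B u -> B v -> B (u + v)) ->
    (forall c u, B u -> B (c *: u)) ->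
    (forall i u, B u -> B (daha_t hq i * u)) ->
    (forall i u, B u -> B (daha_tinv hq i * u)) ->
  forall u, B u.
Proof.
move=> B1 BD BZ Bt Bv u; have [p ->] := quotAlg_pi_surj u.
have Bm (m : seq letter) : B (pi (word m)).
  elim: m => [|[i s] m IHm]; first by rewrite word_nil rmorph1.
  by rewrite word_cons rmorphM; case: s; [apply: Bv|apply: Bt].
rewrite [p]word_sum raddf_sum; elim/big_ind: _ => //.
  by rewrite -(scale0r (1 : daha hq)); apply: BZ.
by move=> [m] _; rewrite /= quotAlg_pi_scalable; apply: BZ.
Qed.

Section Lift.
Variables (S : nzRingType) (phi : {rmorphism F -> S}) (u v : 'I_4 -> S).
Hypothesis phi_central : forall c s, GRing.comm (phi c) s.
Hypothesis uV : forall i, u i * v i = 1.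
Hypothesis Vu : forall i, v i * u i = 1.
Hypothesis uDv_central : forall i s, GRing.comm (u i + v i) s.
Hypothesis u_prod : u 0 * u 1 * u 2 * u 3 = phi q^-1.

Definition eval_word (m : {fmonom letter}) : S :=
  \prod_(j <- m : seq letter) (if j.2 then v j.1 else u j.1).

Fact eval_word_mmorphism : mmorphism eval_word.
Proof.
by split=> [m1 m2|]; rewrite /eval_word ?fmM ?big_cat // fm1 big_nil.
Qed.

HB.instance Definition _ :=
  isMultiplicative.Build {fmonom letter} S eval_word eval_word_mmorphism.

Let ev (p : free) : S := mmap phi eval_word p.

Let evB : {morph ev : x y / x - y}.
Proof. exact: mmapB. Qed.

Let evM : {morph ev : x y / x * y}.
Proof.
exact: (commr_mmap_is_multiplicative (fun p m m' => phi_central _ _)).1.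
Qed.

Let ev1 : ev 1 = 1.
Proof. exact: mmap1. Qed.

Let evZ c p : ev (c *: p) = phi c * ev p.
Proof. exact: mmapZ. Qed.

Let ev_gen i s : ev (freeAlg_gen F (i, s)) = if s then v i else u i.
Proof.
rewrite [LHS]mmapU /= (rmorph1 phi) mul1r.
by rewrite /eval_word fmU big_seq1.
Qed.

Let ev_x i : ev (daha_x F i) = u i.
Proof. exact: (ev_gen i false). Qed.

Let ev_y i : ev (daha_y F i) = v i.
Proof. exact: (ev_gen i true). Qed.

Let ev_commutator (p a : free) :
  (forall s, GRing.comm (ev p) s) -> ev (p * a - a * p) = 0.
Proof. move=> cp; rewrite evB; apply/eqP; rewrite subr_eq0; apply/eqP.
by apply: (etrans (evM p a)); rewrite cp; apply/esym/evM. Qed.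

Let ev_prod4 (a b c d : free) k :
  ev (a * b * c * d - k%:A) = ev a * ev b * ev c * ev d - phi k.
Proof. by rewrite evB !evM evZ ev1 mulr1. Qed.

Let ev_ideal p : ideal_set (daha_ideal hq) p -> ev p = 0.
Proof.
move=> /(_ [set p | ev p = 0]); apply; split; first split.
- by rewrite /mkset -(subrr 1) evB subrr.
- by move=> a b ea eb; rewrite /mkset evB ea eb subrr.
- by move=> a b c eb; rewrite /mkset !evM eb mulr0 mul0r.
move=> r [[[[i ->]|[i ->]]|[i [a ->]]]|->]; rewrite /mkset evB.
- by rewrite (evM (daha_x F i)) ev_x ev_y ev1 uV subrr.
- by rewrite (evM (daha_y F i)) ev_x ev_y ev1 Vu subrr.
- rewrite -evB; apply: ev_commutator => s.
  by rewrite [ev _]mmapD -/(ev (daha_x F i)) -/(ev (daha_y F i)) ev_x ev_y.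
by rewrite -evB ev_prod4 !ev_x u_prod subrr.
Qed.

Let lift (z : daha hq) : S := ev (repr z).

Let lift_pi p : lift (pi p) = ev p.
Proof.
apply/eqP; rewrite -subr_eq0 -evB; apply/eqP/ev_ideal.
by apply/asboolP/quotAlg_eqP; rewrite /quotAlg_pi reprK.
Qed.

Let lift_zmod : zmod_morphism lift.
Proof.
move=> x y; case: (quotAlg_pi_surj x) => a ->.
by case: (quotAlg_pi_surj y) => b ->; rewrite -rmorphB !lift_pi evB.
Qed.

Let lift_monoid : monoid_morphism lift.
Proof.
split=> [|x y]; first by rewrite -(rmorph1 pi) lift_pi ev1.
case: (quotAlg_pi_surj x) => a ->.
by case: (quotAlg_pi_surj y) => b ->; rewrite -rmorphM !lift_pi evM.
Qed.

(** The scalars are sent to S along a ring morphism [phi] with central image, so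
    that S may be a ring of operators over an extension of F. *)
Lemma daha_lift : exists rho : {rmorphism daha hq -> S},
  [/\ forall i, rho (daha_t hq i) = u i,
      forall i, rho (daha_tinv hq i) = v i
    & forall c, rho c%:A = phi c].
Proof.
pose zm := GRing.isZmodMorphism.Build _ _ lift lift_zmod.
pose mm := GRing.isMonoidMorphism.Build _ _ lift lift_monoid.
pose rho : {rmorphism daha hq -> S} := HB.pack lift zm mm.
exists rho; split=> [i|i|c] /=.
- by rewrite lift_pi ev_x.
- by rewrite lift_pi ev_y.
by rewrite -(rmorph1 pi) -quotAlg_pi_scalable lift_pi evZ ev1 mulr1.
Qed.

End Lift.

End UniversalProperty.

(** * Independent parameters *)

Section FreeParameters.
Variables (F : fieldType) (H : algType F) (T : nat -> H).
Hypothesis T_central : forall i u, GRing.comm (T i) u.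

(** Commuting elements T_i are values of independent indeterminates [tau i]. The
    ring R is an iterated polynomial ring; the last clause says, in the form of an
    induction principle, that it is generated by F and the [tau i]. *)
Lemma free_parameters n : exists (R : idomainType) (iota : {rmorphism F -> R})
    (tau : nat -> R) (e : {rmorphism R -> H}),
  [/\ forall c, e (iota c) = c%:A,
      forall i, (i < n)%N -> e (tau i) = T i
    & forall B : set R,
        (forall x y, B x -> B y -> B (x + y)) ->
        (forall x y, B x -> B y -> B (x * y)) ->
        (forall c, B (iota c)) -> (forall i, (i < n)%N -> B (tau i)) ->
      forall r, B r].
Proof.
elim: n => [|n [R [iota [tau [e [e_iota e_tau R_ind]]]]]].
  by exists F, idfun, (fun=> 0), (in_alg H); split.
have cTe : commr_rmorph e (T n) by move=> r; apply: T_central.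
exists {poly R}, (polyC \o iota : {rmorphism F -> {poly R}}).
exists (fun i => if (i < n)%N then (tau i)%:P else 'X).
exists (horner_morph cTe); split=> [c|i|B BD BM Bi Bt].
- by rewrite -e_iota; apply: horner_morphC.
- rewrite ltnS leq_eqVlt => /orP[/eqP->|ltin].
    by rewrite ltnn; apply: horner_morphX.
  by rewrite ltin -(e_tau _ ltin); apply: horner_morphC.
have BC r : B r%:P.
  apply: (R_ind (fun r => B r%:P)) => [x y|x y|c|i ltin].
  - by rewrite polyCD; apply: BD.
  - by rewrite polyCM; apply: BM.
  - exact: Bi.
  by have := Bt i (ltnW ltin); rewrite ltin.
have BX : B 'X by have := Bt n (ltnSn n); rewrite ltnn.
by elim/poly_ind => [|p c Bp]; [rewrite -polyC0 | apply/BD/BC/BM].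
Qed.

End FreeParameters.

(** * The generic representation *)

(** The nodes of the chain: (false, m) sits at height 2m and (true, m) at height
    2m + 1. *)
Definition node : Type := (bool * int)%type.
Definition up (i : node) : node := (~~ i.1, i.2 + i.1%:Z).
Definition down (i : node) : node := (~~ i.1, i.2 - (~~ i.1)%:Z).
(** The two perfect matchings of the chain: [refl k] exchanges the nodes of
    parity k with their upper neighbours. They generate the infinite dihedral
    group. *)
Definition refl (k : bool) (i : node) : node :=
  if i.1 == k then up i else down i.
Definition height (i : node) : int := i.2 *+ 2 + i.1%:Z.

Lemma reflK k : involutive (refl k).
Proof.
by case: k => -[[] m]; rewrite /refl /up /down /= ?subr0 ?addr0 ?addrK ?subrK.
Qed.

Lemma refl_parity k i : (refl k i).1 = ~~ i.1.
Proof. by rewrite /refl; case: ifP. Qed.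

Lemma height_up i : height (up i) = height i + 1.
Proof. by case: i => [[] m]; rewrite /height /up /=; ring. Qed.

Lemma height_down i : height (down i) = height i - 1.
Proof. by case: i => [[] m]; rewrite /height /down /=; ring. Qed.

Definition op (K : fieldType) : nzRingType := oper (false, 0 : int) K.

Section PairOperators.
Variable K : fieldType.
Implicit Types (m u : node -> K) (k : bool).

Definition pair_fun k m u (f : node -> K) (i : node) :=
  m i * f i + u i * f (refl k i).

Fact pair_fun_linear k m u c f g :
  pair_fun k m u (fun i => c * f i + g i) =
  (fun i => c * pair_fun k m u f i + pair_fun k m u g i).
Proof. by apply/funext => i; rewrite /pair_fun; ring. Qed.

Definition pair_op k m u : op K := LinOp (pair_fun_linear k m u).
(** The adjugate of each block, which is its inverse when the determinant is 1. *)
Definition pair_inv k m u : op K := pair_op k (m \o refl k) (fun i => - u i).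

Definition pair_det k m u i := m i * m (refl k i) - u i * u (refl k i).

Lemma pair_opE k m u f i : pair_op k m u f i = m i * f i + u i * f (refl k i).
Proof. by []. Qed.

Lemma pair_opV k m u :
  (forall i, pair_det k m u i = 1) -> pair_op k m u * pair_inv k m u = 1.
Proof.
move=> det1; apply: operE => f i; rewrite operM oper1 !pair_opE /= reflK.
by transitivity (pair_det k m u i * f i); [rewrite /pair_det; ring | rewrite det1 mul1r].
Qed.

Lemma pair_Vop k m u :
  (forall i, pair_det k m u i = 1) -> pair_inv k m u * pair_op k m u = 1.
Proof.
move=> det1; apply: operE => f i; rewrite operM oper1 !pair_opE /= reflK.
by transitivity (pair_det k m u i * f i); [rewrite /pair_det; ring | rewrite det1 mul1r].
Qed.

(** A 2 x 2 matrix plus its adjugate is its trace, which makes the sum of a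
    generator and its inverse central. *)
Lemma pair_opDV k m u t : (forall i, m i + m (refl k i) = t) ->
  pair_op k m u + pair_inv k m u = scal t.
Proof.
move=> tr; apply: operE => f i; rewrite operD !pair_opE /= -(tr i); ring.
Qed.

(** Only the product of the two off-diagonal entries of a block is determined by
    its determinant. Putting 1 on the upward entry makes the coefficient of
    every upward path equal to 1. *)
Definition off_diag k m (i : node) : K :=
  if i.1 == k then 1 else m i * m (refl k i) - 1.

Lemma off_diag_det k m i : pair_det k m (off_diag k m) i = 1.
Proof.
rewrite /pair_det /off_diag refl_parity reflK.
by case: i.1 k => -[] /=; ring.
Qed.

End PairOperators.

Section GenericRepresentation.
Variables (F : fieldType) (q : F) (hq : q != 0).
Variables (K : fieldType) (phi : {rmorphism F -> K}) (T : 'I_4 -> K) (x : K).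
Hypothesis x0 : x != 0.

Let p : K := phi q.
Let kappa : K := p ^- 2.
Hypothesis q_generic : forall n : nat, (0 < n)%N -> q ^+ n != 1.
Hypothesis x_generic : forall m : int, x ^+ 2 != kappa ^ m.

(** The orbit of x under the dihedral group generated by x -> x^-1 and
    x -> kappa x^-1. *)
Definition pt (i : node) : K :=
  if i.1 then kappa ^ (- i.2) * x^-1 else kappa ^ i.2 * x.

Let p0 : p != 0. Proof. by rewrite fmorph_eq0. Qed.
Let kappa0 : kappa != 0. Proof. by rewrite invr_eq0 expf_neq0. Qed.

Lemma pt_neq0 i : pt i != 0.
Proof.
by rewrite /pt; case: ifP => _; apply: mulf_neq0; rewrite ?invr_eq0 ?expfz_neq0.
Qed.

Let pt_refl k i : pt i * pt (refl k i) = if k then kappa else 1.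
Proof.
have E (m n : int) : kappa ^ m * x * (kappa ^ n * x^-1) = kappa ^ (m + n).
  by rewrite mulrACA mulfV // mulr1 expfzDr.
case: k i => -[[] m]; rewrite /pt /refl /up /down /= ?[_ * x^-1 * _]mulrC E.
- by rewrite (_ : _ + _ = 1 :> int) ?expr1z //; ring.
- by rewrite (_ : _ + _ = 1 :> int) ?expr1z //; ring.
- by rewrite (_ : _ + _ = 0 :> int) ?expr0z //; ring.
by rewrite (_ : _ + _ = 0 :> int) ?expr0z //; ring.
Qed.

Lemma pt_inj : injective pt.
Proof.
have kappa_free n : kappa ^+ n = 1 -> n = 0%N.
  move/eqP; rewrite /kappa exprVn -exprM invr_eq1 /p -rmorphXn fmorph_eq1.
  by case: n => // n /eqP E; have := q_generic (n := 2 * n.+1) isT; rewrite E eqxx.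
have kappa_inj : injective (fun m : int => kappa ^ m).
  move=> m n /= E; apply/eqP; rewrite -subr_eq0; apply/eqP.
  have: kappa ^ (m - n) = 1.
    by rewrite expfzDr // -invr_expz E mulfV ?expfz_neq0.
  case: (m - n) => [d /kappa_free-> //|d].
  by rewrite NegzE -invr_expz => /eqP; rewrite invr_eq1 => /eqP/kappa_free.
have odd_even m n : kappa ^ m * x != kappa ^ n * x^-1.
  apply: contra (x_generic (n - m)) => /eqP E.
  rewrite expfzDr // -invr_expz; apply/eqP.
  apply: (mulfI (expfz_neq0 m kappa0)); apply: (mulIf (invr_neq0 x0)).
  by rewrite expr2 mulrA mulfK // E mulrCA mulfV ?expfz_neq0 // mulr1.
case=> [[] m] [[] n]; rewrite /pt /= => E.
- by have /kappa_inj/oppr_inj-> := mulIf (invr_neq0 x0) E.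
- by have := odd_even n (- m); rewrite E eqxx.
- by have := odd_even m (- n); rewrite E eqxx.
by have /kappa_inj-> := mulIf x0 E.
Qed.

Let pt_refl_neq k i : pt (refl k i) - pt i != 0.
Proof.
rewrite subr_eq0; apply/eqP => /pt_inj/(congr1 fst).
by rewrite refl_parity; case: i.1.
Qed.

(* On a pair with coordinates y and y', the diagonal entries m and m' of b solve
   m + m' = T 1 and y m' + y' m = T 0, the second equation being the trace of
   X b^-1. Those of a solve m + m' = T 2 and m y + m' y' = p^-1 T 3, the second
   one being, since y y' = p^-2, the trace of p^-1 a^-1 X^-1. *)
Let diag1 i : K := (T 0 - pt i * T 1) / (pt (refl false i) - pt i).
Let diag2 i : K :=
  (p^-1 * T 3 - pt (refl true i) * T 2) / (pt i - pt (refl true i)).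
Let off1 := off_diag false diag1.
Let off2 := off_diag true diag2.

Let trace1 i : diag1 i + diag1 (refl false i) = T 1.
Proof.
rewrite /diag1 reflK; have := pt_refl_neq false i.
by move: (pt (refl false i)) (pt i) => y' y y0; field; rewrite -(opprB y' y) oppr_eq0 y0.
Qed.

Let trace2 i : diag2 i + diag2 (refl true i) = T 2.
Proof.
rewrite /diag2 reflK; have := pt_refl_neq true i.
by move: (pt (refl true i)) (pt i) => y' y y0; field; rewrite -(opprB y' y) oppr_eq0 y0 p0.
Qed.

(* The blocks of t_0 = X b^-1 and t_3 = p^-1 a^-1 X^-1. *)
Let diag0 i : K := pt i * diag1 (refl false i).
Let off0 i : K := - (pt i * off1 i).
Let diag3 i : K := p^-1 * diag2 (refl true i) * (pt i)^-1.
Let off3 i : K := - (p^-1 * off2 i * (pt (refl true i))^-1).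

Let trace0 i : diag0 i + diag0 (refl false i) = T 0.
Proof.
rewrite /diag0 /diag1 !reflK; have := pt_refl_neq false i.
by move: (pt (refl false i)) (pt i) => y' y y0; field; rewrite -(opprB y' y) oppr_eq0 y0.
Qed.

Let trace3 i : diag3 i + diag3 (refl true i) = T 3.
Proof.
rewrite /diag3 /diag2 !reflK; have := pt_refl_neq true i.
have := pt_refl true i; have := pt_neq0 i; have := pt_neq0 (refl true i).
rewrite /kappa; move: (pt (refl true i)) (pt i) => y' y y'0 y0 /= yy' dy.
transitivity ((y * y')^-1 * p ^- 2 * T 3).
  by field; rewrite -(opprB y' y) oppr_eq0 dy p0 y0 y'0.
by rewrite yy' mulVf ?mul1r // invr_eq0 expf_neq0.
Qed.

Let det0 i : pair_det false diag0 off0 i = 1.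
Proof.
rewrite -[RHS](off_diag_det false diag1 i) /pair_det /diag0 /off0 reflK.
have := pt_refl false i; rewrite -/off1 => /= yy'.
by rewrite -[RHS]mul1r -yy'; ring.
Qed.

Let det3 i : pair_det true diag3 off3 i = 1.
Proof.
rewrite -[RHS](off_diag_det true diag2 i) /pair_det /diag3 /off3 reflK.
have := pt_refl true i; rewrite -/off2 => /= yy'.
transitivity (p ^- 2 * (pt i * pt (refl true i))^-1 *
  (diag2 i * diag2 (refl true i) - off2 i * off2 (refl true i))).
  by rewrite invfM; field; rewrite p0 !pt_neq0.
by rewrite yy' mulfV // mul1r.
Qed.

Definition gen_op (i : 'I_4) : op K :=
  if i == 0 then pair_op false diag0 off0
  else if i == 1 then pair_op false diag1 off1
  else if i == 2 then pair_op true diag2 off2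
  else pair_op true diag3 off3.

Definition gen_inv (i : 'I_4) : op K :=
  if i == 0 then pair_inv false diag0 off0
  else if i == 1 then pair_inv false diag1 off1
  else if i == 2 then pair_inv true diag2 off2
  else pair_inv true diag3 off3.

Let det1 i : pair_det false diag1 off1 i = 1.
Proof. exact: off_diag_det. Qed.

Let det2 i : pair_det true diag2 off2 i = 1.
Proof. exact: off_diag_det. Qed.

Let gen_opV i : gen_op i * gen_inv i = 1.
Proof. by rewrite /gen_op /gen_inv; do !case: eqP => _; apply: pair_opV. Qed.

Let gen_Vop i : gen_inv i * gen_op i = 1.
Proof. by rewrite /gen_op /gen_inv; do !case: eqP => _; apply: pair_Vop. Qed.

Let gen_opDV i : gen_op i + gen_inv i = scal (T i).
Proof.
rewrite /gen_op /gen_inv.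
case: (eqVneq i 0) => [->|n0]; first exact: pair_opDV.
case: (eqVneq i 1) => [->|n1]; first exact: pair_opDV.
case: (eqVneq i 2) => [->|n2]; first exact: pair_opDV.
have -> : i = 3; last exact: pair_opDV.
by apply: val_inj; move: n0 n1 n2; case: i => [[|[|[|[|]]]]].
Qed.

Let gen_op01 : gen_op 0 * gen_op 1 = diag pt.
Proof.
have -> : gen_op 0 = diag pt * gen_inv 1.
  apply: operE => f i; rewrite operM /= /pair_fun /= /diag0 /off0; ring.
by rewrite -mulrA gen_Vop mulr1.
Qed.

Let gen_op23 : gen_op 2 * gen_op 3 = diag (fun i => p^-1 / pt i).
Proof.
have -> : gen_op 3 = gen_inv 2 * diag (fun i => p^-1 / pt i).
  apply: operE => f i; rewrite operM /= /pair_fun /= /diag3 /off3 /=.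
  by ring.
by rewrite mulrA gen_opV mul1r.
Qed.

(** The genericity conditions on q and x make the coordinates distinct, so that
    the linear systems for the diagonal entries are solvable. The values of the
    T_i are arbitrary. *)
Lemma generic_representation : exists rho : {rmorphism daha hq -> op K},
  [/\ forall c, rho c%:A = scal (phi c),
      forall i, rho (daha_T hq i) = scal (T i),
      rho (daha_t hq 0 * daha_t hq 1) = diag pt
    & forall k, exists m u, (forall i, i.1 = k -> u i = 1) /\
        rho (daha_t hq (if k then 2 else 1)) = pair_op k m u].
Proof.
pose sphi : {rmorphism F -> op K} := scal \o phi.
have sphi_central c s : GRing.comm (sphi c) s by apply: scal_central.
have T_central i s : GRing.comm (gen_op i + gen_inv i) s.
  by rewrite gen_opDV; apply: scal_central.
have prod4 : gen_op 0 * gen_op 1 * gen_op 2 * gen_op 3 = sphi q^-1.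
  rewrite gen_op01 -mulrA gen_op23; apply: operE => f i.
  by rewrite operM /= fmorphV -/p mulrA mulrCA divff ?pt_neq0 ?mulr1.
have [rho [rho_t rho_v rho_c]] :=
  daha_lift hq sphi_central gen_opV gen_Vop T_central prod4.
exists rho; split=> //.
- by move=> i; rewrite rmorphD rho_t rho_v gen_opDV.
- by rewrite rmorphM !rho_t gen_op01.
case; [exists diag2, off2 | exists diag1, off1]; rewrite rho_t; split=> // i ik.
- by rewrite /off2 /off_diag ik.
by rewrite /off1 /off_diag ik.
Qed.

End GenericRepresentation.

(** * Spanning by alternating words *)

Lemma comp_poly_scaleX_coef (R : comNzRingType) (c : R) (p : {poly R}) j :
  (p \Po (c *: 'X))`_j = c ^+ j * p`_j.
Proof.
rewrite comp_polyE (eq_bigr (fun i : 'I_(size p) => (p`_i * c ^+ i) *: 'X^i)).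
  rewrite -(poly_def (size p) (fun i => p`_i * c ^+ i)) coef_poly.
  case: ltnP => [_|size_le]; first by rewrite mulrC.
  by rewrite nth_default ?mulr0.
by move=> i _; rewrite exprZn scalerA.
Qed.

(** The spanning and separation arguments are carried out in an algebra H that is
    given by relations only; [e] substitutes the T_i for independent parameters. *)
Section NormalForm.
Variables (F : fieldType) (q : F) (hq : q != 0) (H : algType F).
Variables (t v : 'I_4 -> H).
Hypothesis tV : forall i, t i * v i = 1.
Hypothesis Vt : forall i, v i * t i = 1.
Hypothesis t_prod : t 0 * t 1 * t 2 * t 3 = q^-1%:A.
Variables (R : idomainType) (iota : {rmorphism F -> R}) (tau : 'I_4 -> R).
Variable e : {rmorphism R -> H}.
Hypothesis e_iota : forall c, e (iota c) = c%:A.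
Hypothesis e_tau : forall i, e (tau i) = t i + v i.
Hypothesis e_central : forall r u, GRing.comm (e r) u.

Variables X Xinv : H.
Hypothesis XE : X = t 0 * t 1.
Hypothesis XinvE : Xinv = v 1 * v 0.

Lemma XV : X * Xinv = 1.
Proof. by rewrite XE XinvE mulrA -[t 0 * _ * _]mulrA tV mulr1 tV. Qed.

Lemma VX : Xinv * X = 1.
Proof. by rewrite XE XinvE mulrA -[v 1 * _ * _]mulrA Vt mulr1 Vt. Qed.

Lemma X_comm_e : commr_rmorph e X.
Proof. by move=> r; apply: commr_sym. Qed.

Definition ev : {poly R} -> H := horner_morph X_comm_e.
HB.instance Definition _ := GRing.RMorphism.on ev.

Lemma evX : ev 'X = X.
Proof. exact: horner_morphX. Qed.

Lemma evC r : ev r%:P = e r.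
Proof. exact: horner_morphC. Qed.

Lemma ev_comm_Xinv n p : GRing.comm (Xinv ^+ n) (ev p).
Proof.
apply/commr_sym/commrX; rewrite /GRing.comm -[LHS]mul1r -VX -!mulrA; congr (_ * _).
by rewrite mulrA -evX -rmorphM -commr_polyX rmorphM /= evX -mulrA XV mulr1.
Qed.

(** The subalgebra L. Writing a Laurent polynomial as X^-n times a polynomial
    makes it an image under the ring morphism [ev]. *)
Definition laurent : set H := [set P | exists n p, P = Xinv ^+ n * ev p].

Lemma laurent_ev p : laurent (ev p).
Proof. by exists 0%N, p; rewrite mul1r. Qed.

Lemma laurent_e r : laurent (e r).
Proof. by rewrite -evC; apply: laurent_ev. Qed.

Lemma laurent1 : laurent 1.
Proof. by rewrite -(rmorph1 e); apply: laurent_e. Qed.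

Lemma laurent_X : laurent X.
Proof. by rewrite -evX; apply: laurent_ev. Qed.

Lemma laurent_Xinv : laurent Xinv.
Proof. by exists 1%N, 1; rewrite rmorph1 mulr1. Qed.

Lemma XinvMX n : Xinv ^+ n * X ^+ n = 1.
Proof.
elim: n => [|n IHn]; first by rewrite mulr1.
by rewrite exprSr exprS mulrA -(mulrA _ Xinv X) VX mulr1.
Qed.

Lemma XinvDX n m : Xinv ^+ (n + m) * X ^+ m = Xinv ^+ n.
Proof. by rewrite exprD -mulrA XinvMX mulr1. Qed.

Lemma laurentD P Q : laurent P -> laurent Q -> laurent (P + Q).
Proof.
move=> [n [p ->]] [m [r ->]]; exists (n + m)%N, ('X^m * p + 'X^n * r).
rewrite rmorphD !rmorphM !rmorphXn /= evX mulrDr !mulrA XinvDX.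
by rewrite addnC XinvDX.
Qed.

Lemma laurentM P Q : laurent P -> laurent Q -> laurent (P * Q).
Proof.
move=> [n [p ->]] [m [r ->]]; exists (n + m)%N, (p * r).
by rewrite rmorphM exprD -!mulrA; congr (_ * _); rewrite !mulrA -ev_comm_Xinv.
Qed.

Lemma laurentZ c P : laurent P -> laurent (c *: P).
Proof.
by move=> LP; rewrite -mulr_algl -e_iota; apply: laurentM => //; apply: laurent_e.
Qed.

Lemma laurentN P : laurent P -> laurent (- P).
Proof. by rewrite -scaleN1r; apply: laurentZ. Qed.

Definition gen (k : bool) : H := t (if k then 2 else 1).

(* The coefficients that can be moved across g; they form a subalgebra, so only
   the generators of L have to be checked. *)
Let straight g P := laurent P /\
  exists P1 P2, [/\ laurent P1, laurent P2 & g * P = P1 * g + P2].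

Let straightM g P Q : straight g P -> straight g Q -> straight g (P * Q).
Proof.
move=> [LP [P1 [P2 [LP1 LP2 gP]]]] [LQ [Q1 [Q2 [LQ1 LQ2 gQ]]]].
split; first exact: laurentM.
exists (P1 * Q1), (P1 * Q2 + P2 * Q).
split; [exact: laurentM | by apply: laurentD; apply: laurentM |].
by rewrite mulrA gP mulrDl -mulrA gQ mulrDr !mulrA addrA.
Qed.

Let straightD g P Q : straight g P -> straight g Q -> straight g (P + Q).
Proof.
move=> [LP [P1 [P2 [LP1 LP2 gP]]]] [LQ [Q1 [Q2 [LQ1 LQ2 gQ]]]].
split; first exact: laurentD.
exists (P1 + Q1), (P2 + Q2); split; [exact: laurentD|exact: laurentD|].
by rewrite mulrDr gP gQ mulrDl addrACA.
Qed.

Let straight_e g r : straight g (e r).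
Proof.
split; first exact: laurent_e.
exists (e r), 0; split; [exact: laurent_e | | by rewrite addr0 e_central].
by rewrite -(rmorph0 e); apply: laurent_e.
Qed.

Lemma t3E : q *: t 3 = v 2 * Xinv.
Proof.
have <- : v 2 * Xinv * (X * t 2 * t 3) = t 3.
  by rewrite -!mulrA (mulrA Xinv) VX mul1r mulrA Vt mul1r.
by rewrite {1}XE t_prod mulr_algr scalerA mulfV ?scale1r.
Qed.

(* This is where centrality of T_0 (for b) and of T_3 (for a) enters. *)
Let straight_Xinv k : exists c E,
  [/\ c != 0, laurent E & gen k * Xinv = c *: (X * gen k) + E].
Proof.
case: k.
  have v3E : v 3 = q *: (X * t 2).
    rewrite XE -[RHS]mulr1 -(tV 3) -scalerAl mulrA t_prod mulr_algl scalerA.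
    by rewrite mulfV ?scale1r.
  exists (q ^+ 2), (e (tau 2) * Xinv - q *: e (tau 3)); split.
  - by rewrite expf_neq0.
  - apply: laurentD; first exact/laurentM/laurent_Xinv/laurent_e.
    exact/laurentN/laurentZ/laurent_e.
  rewrite !e_tau mulrDl scalerDr t3E v3E scalerA -expr2 /gen /=.
  by rewrite opprD (addrA (_ + _)) addrK [RHS]addrC subrK.
exists 1, (e (tau 0) - e (tau 1) * X); split; first exact: oner_neq0.
  apply: laurentD; first exact: laurent_e.
  exact/laurentN/laurentM/laurent_X/laurent_e.
rewrite e_central !e_tau scale1r mulrDr /gen /= XinvE mulrA tV mul1r.
have -> : X * v 1 = t 0 by rewrite XE -mulrA tV mulr1.
by rewrite [RHS]addrC opprD addrA addrAC subrK addrAC subrr add0r.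
Qed.

(* Multiplying the rule for X^-1 by X^-1 on the left and by X on the right turns
   it into a rule for X. *)
Let straight_X k : straight (gen k) X.
Proof.
have [c [E [c0 LE gX]]] := straight_Xinv k.
split; first exact: laurent_X.
exists (c^-1 *: Xinv), (- (c^-1 *: (Xinv * E * X))); split.
- exact/laurentZ/laurent_Xinv.
- apply/laurentN/laurentZ/laurentM/laurent_X/laurentM => //.
  exact: laurent_Xinv.
have : Xinv * (gen k * Xinv) * X = c *: (gen k * X) + Xinv * E * X.
  by rewrite gX mulrDr mulrDl -scalerAr -scalerAl mulrA VX mul1r.
rewrite -!mulrA VX mulr1 => E1; rewrite -scalerAl E1 scalerDr scalerA mulVf //.
by rewrite scale1r addrK.
Qed.

Lemma gen_laurent k P : laurent P ->
  exists P1 P2, [/\ laurent P1, laurent P2 & gen k * P = P1 * gen k + P2].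
Proof.
move=> [n [p ->]]; suff [] : straight (gen k) (Xinv ^+ n * ev p) by [].
apply: straightM; last first.
  elim/poly_ind: p => [|p c IHp]; first by rewrite -polyC0 evC; apply: straight_e.
  rewrite rmorphD rmorphM /= evX evC; apply: straightD (straight_e _ _).
  exact: straightM (straight_X k).
elim: n => [|n IHn]; first by rewrite expr0 -(rmorph1 e); apply: straight_e.
rewrite exprSr; apply: straightM => //.
have [c [E [_ LE gX]]] := straight_Xinv k.
split; first exact: laurent_Xinv.
exists (c *: X), E; split=> //; first exact/laurentZ/laurent_X.
by rewrite gX scalerAl.
Qed.

(** The alternating word of length l whose first letter is [gen k]. *)
Fixpoint word (k : bool) (l : nat) : H :=
  if l is l'.+1 then gen k * word (~~ k) l' else 1.

(** Recursion on the length exposes the two coefficients of the longest words,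
    which is what the descent on central elements peels off. *)
Fixpoint word_span (l : nat) : set H :=
  if l is l'.+1 then
    [set z | exists s P Q, [/\ word_span l' s, laurent P, laurent Q
       & z = s + P * word true l + Q * word false l]]
  else laurent.

Lemma span0 l : word_span l 0.
Proof.
have L0 : laurent 0 by rewrite -(rmorph0 e); apply: laurent_e.
elim: l => [|l IHl] //=; exists 0, 0, 0; split=> //.
by rewrite !mul0r !addr0.
Qed.

Lemma laurent0 : laurent 0.
Proof. exact: (span0 0). Qed.

Lemma spanS l z : word_span l z -> word_span l.+1 z.
Proof.
move=> Sz; exists z, 0, 0; split; [by []|exact: laurent0|exact: laurent0|].
by rewrite !mul0r !addr0.
Qed.

Lemma spanD l z w : word_span l z -> word_span l w -> word_span l (z + w).
Proof.
elim: l z w => [|l IHl] z w; first exact: laurentD.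
move=> [s [P [Q [Ss LP LQ ->]]]] [s' [P' [Q' [Ss' LP' LQ' ->]]]].
exists (s + s'), (P + P'), (Q + Q'); split; [exact: IHl|exact: laurentD|exact: laurentD|].
by rewrite !mulrDl addrACA [s + _ + _]addrACA.
Qed.

Lemma span_laurentM l P z : laurent P -> word_span l z -> word_span l (P * z).
Proof.
move=> LP; elim: l z => [|l IHl] z; first exact: laurentM.
move=> [s [P' [Q [Ss LP' LQ ->]]]].
exists (P * s), (P * P'), (P * Q); split; [exact: IHl|exact: laurentM|exact: laurentM|].
by rewrite !mulrDr !mulrA.
Qed.

Lemma span_word k l P : laurent P -> word_span l (P * word k l).
Proof.
case: l => [|l] LP; first by rewrite mulr1.
by case: k; [exists 0, P, 0 | exists 0, 0, P]; split;
  rewrite ?mul0r ?add0r ?addr0 //; try exact: span0; try exact: laurent0.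
Qed.

Lemma gen_sqr k : gen k * gen k = e (tau (if k then 2 else 1)) * gen k - 1.
Proof. by rewrite e_tau mulrDl Vt addrK. Qed.

(** A letter either lengthens an alternating word or meets itself, in which case
    the quadratic relation applies. *)
Lemma span_gen_word k j l : word_span l.+1 (gen k * word j l).
Proof.
have [->|/negPf kj] := eqVneq j (~~ k).
  by rewrite -[_ * _]/(word k l.+1) -[word _ _]mul1r; apply/span_word/laurent1.
have {kj} -> : j = k by case: j k kj => -[].
case: l => [|l].
  (* The empty word does not depend on k. *)
  rewrite -[word k _]/(word (~~ k) 0) -[_ * _]/(word k 1) -[word _ _]mul1r.
  exact/span_word/laurent1.
rewrite -[word k _]/(gen k * word (~~ k) l) mulrA gen_sqr mulrBl mul1r -mulrA.
rewrite -[gen k * _]/(word k l.+1).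
apply: spanD; first exact/spanS/span_word/laurent_e.
do 2!apply: spanS; rewrite -mulN1r; apply: span_word.
exact/laurentN/laurent1.
Qed.

Lemma span_genM k l z : word_span l z -> word_span l.+1 (gen k * z).
Proof.
have gPw j l' P : laurent P -> word_span l'.+1 (gen k * (P * word j l')).
  move=> LP; have [P1 [P2 [LP1 LP2 gP]]] := gen_laurent k LP.
  rewrite mulrA gP mulrDl -mulrA; apply: spanD; last exact/spanS/span_word.
  exact/span_laurentM/span_gen_word.
elim: l z => [|l IHl] z.
  by move=> Lz; rewrite -[z]mulr1 -[1]/(word true 0); apply: gPw.
move=> [s [P [Q [Ss LP LQ ->]]]]; rewrite !mulrDr.
by apply/spanD/gPw => //; apply/spanD/gPw => //; apply/spanS/IHl.
Qed.

Definition spanned : set H := [set z | exists l, word_span l z].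

Lemma spannedD z w : spanned z -> spanned w -> spanned (z + w).
Proof.
have leS l d u : word_span l u -> word_span (d + l) u by elim: d => //= d IHd /IHd/spanS.
by move=> [l Sz] [m Sw]; exists (l + m)%N; apply: spanD; [rewrite addnC|]; apply: leS.
Qed.

Lemma spanned1 : spanned 1.
Proof. by exists 0%N; apply: laurent1. Qed.

Lemma spanned_laurentM P z : laurent P -> spanned z -> spanned (P * z).
Proof. by move=> LP [l Sz]; exists l; apply: span_laurentM. Qed.

Lemma spanned_genM k z : spanned z -> spanned (gen k * z).
Proof. by move=> [l Sz]; exists l.+1; apply: span_genM. Qed.

Lemma spannedZ c z : spanned z -> spanned (c *: z).
Proof.
by move=> Sz; rewrite -mulr_algl -e_iota; apply: spanned_laurentM => //; apply: laurent_e.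
Qed.

Lemma spannedN z : spanned z -> spanned (- z).
Proof. by rewrite -scaleN1r; apply: spannedZ. Qed.

Lemma spannedVM i z :
  (forall w, spanned w -> spanned (t i * w)) -> spanned z -> spanned (v i * z).
Proof.
move=> St Sz; have -> : v i * z = e (tau i) * z - t i * z.
  by rewrite e_tau mulrDl addrAC subrr add0r.
by apply: spannedD; [apply: spanned_laurentM (laurent_e _) _ | apply/spannedN/St].
Qed.

Lemma spanned_tM i z : spanned z -> spanned (t i * z).
Proof.
have S1 w : spanned w -> spanned (t 1 * w) := @spanned_genM false w.
have S2 w : spanned w -> spanned (t 2 * w) := @spanned_genM true w.
move=> Sz.
case: (eqVneq i 1) => [->|n1]; first exact: S1.
case: (eqVneq i 2) => [->|n2]; first exact: S2.
case: (eqVneq i 0) => [->|n0].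
  have -> : t 0 = X * v 1 by rewrite XE -mulrA tV mulr1.
  by rewrite -mulrA; apply/(spanned_laurentM laurent_X)/spannedVM.
have -> : i = 3 by apply: val_inj; move: n0 n1 n2; case: i => [[|[|[|[|]]]]].
rewrite -[t 3]scale1r -(mulVf hq) -scalerA t3E.
rewrite -scalerAl -mulrA; apply/spannedZ/spannedVM => //.
exact: spanned_laurentM laurent_Xinv _.
Qed.

Lemma spanned_vM i z : spanned z -> spanned (v i * z).
Proof. by move=> Sz; apply: spannedVM => // w; apply: spanned_tM. Qed.

(** * Separation of coefficients *)

Section Representation.
Variables (K : fieldType) (j : {rmorphism R -> K}) (pt : node -> K).
Hypothesis pt_neq0 : forall i, pt i != 0.
Hypothesis pt_inj : injective pt.
Variable rho : {rmorphism H -> op K}.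
Hypothesis rho_e : forall r, rho (e r) = scal (j r).
Hypothesis rho_X : rho X = diag pt.
Hypothesis rho_gen : forall k, exists m u,
  (forall i, i.1 = k -> u i = 1) /\ rho (gen k) = pair_op k m u.

Definition eval_at (i : node) (p : {poly R}) : K := (map_poly j p).[pt i].

Lemma rho_ev p : rho (ev p) = diag (eval_at ^~ p).
Proof.
elim/poly_ind: p => [|p c IHp].
  rewrite !rmorph0; apply: operE => f i.
  by rewrite /eval_at /= rmorph0 horner0.
rewrite !(rmorphD, rmorphM) /= evX evC rho_X rho_e IHp.
apply: operE => f i; rewrite operD operM /=.
by rewrite /eval_at rmorphD rmorphM /= map_polyX map_polyC hornerMXaddC mulrDl mulrA.
Qed.

Lemma rho_laurent n p f i :
  rho (Xinv ^+ n * ev p) f i = pt i ^- n * eval_at i p * f i.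
Proof.
have E : rho (X ^+ n) * rho (Xinv ^+ n * ev p) = diag (eval_at ^~ p).
  rewrite -rho_ev -rmorphM mulrA; congr (rho _).
  have -> : X ^+ n * Xinv ^+ n = 1; last exact: mul1r.
  elim: n => [|n IHn]; first by rewrite mulr1.
  by rewrite exprSr exprS mulrA -(mulrA _ X Xinv) XV mulr1.
have rX g : rho (X ^+ n) g i = pt i ^+ n * g i.
  elim: (n) g => [|l IHl] g; first by rewrite rmorph1 oper1 mul1r.
  by rewrite exprS rmorphM operM rho_X /= IHl exprS mulrA.
have /(congr1 (fun A : op K => A f i)) := E; rewrite operM rX /= => Ei.
by rewrite -mulrA -Ei mulrA mulVf ?mul1r // expf_neq0.
Qed.

Lemma height_refl k i : (height (refl k i) <= height i + 1)%R.
Proof.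
by rewrite /refl; case: ifP => _; rewrite ?height_up ?height_down; lia.
Qed.

Lemma rho_genM k : exists m u, (forall i, i.1 = k -> u i = 1) /\
  forall w f i, rho (gen k * w) f i = m i * rho w f i + u i * rho w f (refl k i).
Proof.
have [m [u [u1 rho_g]]] := rho_gen k.
by exists m, u; split=> // w f i; rewrite rmorphM operM rho_g.
Qed.

(** Each letter moves a node at most one step up. *)
Lemma rho_word_below k l f i :
  (forall n, (height n <= height i + l%:Z)%R -> f n = 0) -> rho (word k l) f i = 0.
Proof.
elim: l k i => [|l IHl] k i f0.
  by rewrite rmorph1 oper1 f0 // addr0.
have [m [u [_ rho_g]]] := rho_genM k.
rewrite rho_g !IHl ?mulr0 ?addr0 // => n hn; apply: f0.
  by have := height_refl k i; lia.
by lia.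
Qed.

Lemma rho_span_below l s f i : word_span l s ->
  (forall n, (height n <= height i + l%:Z)%R -> f n = 0) -> rho s f i = 0.
Proof.
elim: l s => [|l IHl] s.
  by move=> [n [p ->]] f0; rewrite rho_laurent f0 ?mulr0 // addr0.
move=> [s' [P [Q [Ss [n [p ->]] [n' [p' ->]] ->]]]] f0.
rewrite !rmorphD !operD IHl //; last by move=> b hb; apply: f0; lia.
rewrite [rho (_ * word true _)]rmorphM [rho (_ * word false _)]rmorphM !operM.
by rewrite !rho_laurent !rho_word_below // !mulr0 !addr0.
Qed.

Lemma height_iter_up l i : height (iter l up i) = height i + l%:Z.
Proof. by elim: l => [|l IHl] /=; [rewrite addr0 | rewrite height_up IHl; lia]. Qed.

(** Starting at a node of parity k, every letter of the word can move up, and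
    moving up at every letter is the only way to gain l steps. *)
Lemma rho_word_top k l f i : i.1 = k ->
    (forall n, (height n < height i + l%:Z)%R -> f n = 0) ->
  rho (word k l) f i = f (iter l up i).
Proof.
elim: l k i => [|l IHl] k i ik f0; first by rewrite rmorph1 oper1.
have [m [u [u1 rho_g]]] := rho_genM k.
rewrite rho_g rho_word_below ?mulr0 ?add0r; last by move=> n hn; apply: f0; lia.
have -> : refl k i = up i by rewrite /refl ik eqxx.
rewrite u1 // mul1r IHl ?iterSr //; first by rewrite /up /= ik.
by move=> n; rewrite height_up => hn; apply: f0; lia.
Qed.

Definition delta (a : node) : node -> K := fun n => (n == a :> bool * int)%:R.

(** X acts diagonally with distinct eigenvalues. *)
Lemma rho_comm_X z a i : GRing.comm z X -> i <> a -> rho z (delta a) i = 0.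
Proof.
move=> zX ia; have /(congr1 (fun A : op K => A (delta a) i)) := congr1 rho zX.
rewrite !rmorphM !operM rho_X /=.
have -> : (fun n => pt n * delta a n) = (fun n => pt a * delta a n).
  by apply/funext => n; rewrite /delta; case: eqP => [->|]; rewrite ?mulr0.
rewrite linopZ => /eqP; rewrite -subr_eq0 -mulrBl mulf_eq0 subr_eq0.
by case/orP=> /eqP // /pt_inj/esym.
Qed.

(** Apply z to the indicator of the node l + 1 steps above i and evaluate at i:
    the result is 0 as z is diagonal, and only the word starting with [gen k]
    contributes. *)
Lemma top_coefficient k l s n p P' i z : i.1 = k -> word_span l s -> laurent P' ->
    z = s + Xinv ^+ n * ev p * word k l.+1 + P' * word (~~ k) l.+1 ->
  GRing.comm z X -> eval_at i p = 0.
Proof.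
move=> ik Ss [n' [p' ->]] zE zX.
pose a := iter l.+1 up i.
have ha : height a = height i + l.+1%:Z by rewrite height_iter_up.
have da b : (height b < height i + l.+1%:Z)%R -> delta a b = 0.
  by move=> hb; rewrite /delta; case: eqP => // ba; move: hb; rewrite ba ha; lia.
have ia : i <> a by move=> /(congr1 height); rewrite ha; lia.
have := rho_comm_X zX ia; rewrite zE !rmorphD !operD (rho_span_below Ss); last first.
  by move=> b hb; apply: da; lia.
rewrite !(rmorphM _ (_ * ev _)) !operM !rho_laurent rho_word_top // -/a.
have -> : rho (word (~~ k) l.+1) (delta a) i = 0.
  have [m [u [_ rho_g]]] := rho_genM (~~ k).
  rewrite rho_g !rho_word_below ?mulr0 ?addr0 // => b hb; apply: da; last by lia.
  move: hb; rewrite /refl ik; case: (k) => /=; rewrite height_down; lia.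
rewrite /delta eqxx mulr1 mulr0 addr0 add0r => /eqP.
by rewrite mulf_eq0 invr_eq0 expf_eq0 (negPf (pt_neq0 i)) andbF => /eqP.
Qed.

(** Compare the off-diagonal entries at (i, up i) of z g and g z, where g links
    the two nodes with entry 1. *)
Lemma laurent_up n p i : (forall k, GRing.comm (Xinv ^+ n * ev p) (gen k)) ->
  pt i ^- n * eval_at i p = pt (up i) ^- n * eval_at (up i) p.
Proof.
move=> zg; have [m [u [u1 rho_g]]] := rho_gen i.1.
have /(congr1 (fun A : op K => A (delta (up i)) i)) := congr1 rho (zg i.1).
rewrite (rmorphM rho _ (gen i.1)) (rmorphM rho (gen i.1)) !operM.
rewrite rho_laurent rho_g !pair_opE !rho_laurent.
have -> : refl i.1 i = up i by rewrite /refl eqxx.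
rewrite u1 // /delta eqxx !mul1r !mulr1.
have -> : (i == up i :> bool * int) = false.
  by apply/eqP => /(congr1 height); rewrite height_up; lia.
by rewrite !mulr0 !add0r mulr1.
Qed.

End Representation.

(** * Central elements *)

Section Center.
Hypothesis q_generic : forall n : nat, (0 < n)%N -> q ^+ n != 1.
Hypothesis H_ind : forall B : set H,
    B 1 -> (forall z w, B z -> B w -> B (z + w)) ->
    (forall c z, B z -> B (c *: z)) ->
    (forall i z, B z -> B (t i * z)) -> (forall i z, B z -> B (v i * z)) ->
  forall z, B z.

Variables (K : fieldType) (j : {rmorphism R -> K}) (y : K).
Hypothesis y_free : forall p : {poly R}, (map_poly j p).[y] = 0 -> p = 0.

Let phi : {rmorphism F -> K} := j \o iota.

Hypothesis rep : forall x : K, x != 0 ->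
    (forall m : int, x ^+ 2 != (phi q) ^- 2 ^ m) ->
  exists rho : {rmorphism H -> op K},
  [/\ forall r, rho (e r) = scal (j r), rho X = diag (pt q phi x)
    & forall k, exists m u, (forall i, i.1 = k -> u i = 1) /\
        rho (gen k) = pair_op k m u].

Let expr_generic_inj : injective (fun i : nat => q ^- 2 ^+ i).
Proof.
move=> a b; wlog ab : a b / (a <= b)%N => [hw|].
  by case: (leqP a b) => [/hw//|/ltnW/hw {}hw /esym/hw].
rewrite -(subnKC ab); case: (b - a)%N => [|d]; first by rewrite addn0.
move/esym/eqP; rewrite exprD -subr_eq0 -{2}[_ ^+ a]mulr1 -mulrBr mulf_eq0.
rewrite expf_eq0 invr_eq0 expf_eq0 (negPf hq) !andbF subr_eq0 exprVn invr_eq1.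
by rewrite -exprM (negPf (q_generic _)).
Qed.

Let kappa : K := (phi q) ^- 2.

Let kappa_const m : kappa ^ m = j (iota (q ^- 2 ^ m)).
Proof. by rewrite /kappa -[j _]/(phi _) fmorphXz fmorphV rmorphXn. Qed.

Let kappa0 : kappa != 0.
Proof. by rewrite invr_eq0 expf_neq0 // fmorph_eq0. Qed.

Let y_neq0 : y != 0.
Proof.
apply/eqP => y0; have /eqP : 'X = 0 :> {poly R} by apply: y_free; rewrite map_polyX hornerX.
by rewrite polyX_eq0.
Qed.

Let y_generic m : y ^+ 2 != kappa ^ m.
Proof.
rewrite kappa_const; set c := iota _; apply/eqP => yc.
have /(congr1 (fun p : {poly R} => p`_2)) : 'X^2 - c%:P = 0.
  by apply: y_free; rewrite rmorphB /= map_polyXn map_polyC !hornerE yc subrr.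
by rewrite coefB coefXn coefC subr0 coef0; apply/eqP; rewrite oner_eq0.
Qed.

(** A word starting with [gen k] is detected at nodes of parity k, so such a node
    must carry the generic coordinate y. Node (false, 0) carries x and node
    (true, 0) carries x^-1, whence x is y or its inverse. *)
Lemma generic_node_representation (k : bool) :
  exists (pts : node -> K) (i : node) (rho : {rmorphism H -> op K}),
  [/\ i.1 = k, pts i = y, injective pts & forall i', pts i' != 0] /\
  [/\ forall r, rho (e r) = scal (j r), rho X = diag pts,
      forall k, exists m u, (forall i, i.1 = k -> u i = 1) /\
        rho (gen k) = pair_op k m u
    & k = false -> pts (up (up i)) = kappa * y].
Proof.
pose x : K := if k then y^-1 else y.
have x0 : x != 0 by rewrite /x; case: k {x}; rewrite ?invr_eq0 y_neq0.
have xg m : x ^+ 2 != kappa ^ m.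
  rewrite /x; case: k {x x0}; last exact: y_generic.
  by rewrite exprVn -[kappa ^ m]invrK (inj_eq invr_inj) invr_expz y_generic.
have [rho [rho_e rho_X rho_g]] := rep x0 xg.
exists (pt q phi x), (k, 0), rho; split; split.
- by [].
- by rewrite /pt /x /=; case: k {x x0 xg rho_X}; rewrite ?oppr0 expr0z mul1r ?invrK.
- exact: (pt_inj hq x0 q_generic xg).
- by move=> i'; apply: pt_neq0.
- exact: rho_e.
- exact: rho_X.
- exact: rho_g.
by move=> k0; rewrite /pt /x k0 /up /= !add0r expr1z.
Qed.

Lemma all_spanned z : exists l, word_span l z.
Proof.
move: z; apply: (H_ind (B := spanned)).
- exact: spanned1.
- exact: spannedD.
- exact: spannedZ.
- exact: spanned_tM.
exact: spanned_vM.
Qed.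

(** Descent on the length: the coefficients of both longest words vanish. *)
Lemma central_laurent l z : ring_center z -> word_span l z -> laurent z.
Proof.
elim: l z => [|l IHl] z zC //= [s [P [Q [Ss LP LQ zE]]]].
have top0 k n p P' : laurent P' ->
    z = s + Xinv ^+ n * ev p * word k l.+1 + P' * word (~~ k) l.+1 ->
    p = 0.
  move=> LP' zE'.
  have [pts [i [rho [[ik yE pts_inj pts0] [rho_e rho_X rho_g _]]]]] :=
    generic_node_representation k.
  apply: y_free; rewrite -yE.
  exact: (top_coefficient pts0 pts_inj rho_e rho_X rho_g ik Ss LP' zE' (zC _)).
have P0 : P = 0.
  have [n [p PE]] := LP; rewrite PE (top0 true n p Q LQ) -?PE //.
  by rewrite rmorph0 mulr0.
have Q0 : Q = 0.
  have [n [p QE]] := LQ; rewrite QE (top0 false n p P LP) -?QE //.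
    by rewrite rmorph0 mulr0.
  by rewrite zE addrAC.
by apply: IHl => //; rewrite zE P0 Q0 !mul0r !addr0.
Qed.

(** The entries of z at a node with coordinate y and two steps higher, with
    coordinate kappa y, are equal. Comparing coefficients of powers of y leaves
    a single monomial, the one cancelled by X^-n. *)
Lemma center_parameters z : ring_center z -> exists r, z = e r.
Proof.
move=> zC; have [l Sz] := all_spanned z.
have [n [p zE]] := central_laurent zC Sz.
have [pts [i [rho [[ik yE pts_inj pts0] [rho_e rho_X rho_g ptsE]]]]] :=
  generic_node_representation false.
have zg k : GRing.comm (Xinv ^+ n * ev p) (gen k) by rewrite -zE.
have up_eq i' := laurent_up pts0 rho_e rho_X rho_g i' zg.
have := etrans (up_eq i) (up_eq (up i)); rewrite /eval_at yE ptsE // => E.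
pose c := iota (q ^- 2).
have jc : j c = kappa by rewrite -(kappa_const 1) expr1z.
have pE : p \Po (c *: 'X) = c ^+ n *: p.
  apply/eqP; rewrite -subr_eq0; apply/eqP/y_free.
  rewrite rmorphB /= hornerD hornerN map_comp_poly horner_comp !map_polyZ map_polyX !hornerZ.
  rewrite hornerX rmorphXn /= jc; apply/eqP; rewrite subr_eq0; apply/eqP.
  have ky0 : (kappa * y) ^+ n != 0 by rewrite expf_neq0 // mulf_neq0.
  apply: (mulfI (invr_neq0 ky0)); rewrite -E exprMn invfM mulrACA.
  by rewrite mulVf ?mul1r // expf_neq0.
have c_inj : injective (fun i => c ^+ i).
  by move=> i1 i2; rewrite /c -!rmorphXn => /fmorph_inj; apply: expr_generic_inj.
have pXn : p = (p`_n)%:P * 'X^n.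
  apply/polyP => d; rewrite coefCM coefXn; case: eqP => [->|dn]; first by rewrite mulr1.
  have /eqP := congr1 (fun r : {poly R} => r`_d) pE.
  rewrite comp_poly_scaleX_coef coefZ -subr_eq0 -mulrBl mulf_eq0 subr_eq0 mulr0.
  by case/orP=> /eqP // /c_inj.
exists p`_n; rewrite zE {1}pXn rmorphM rmorphXn /= evX evC e_central mulrA.
by rewrite XinvMX mul1r.
Qed.

End Center.

End NormalForm.

(** * The center of the universal DAHA *)

(** The class of 'X in the fraction field is thus transcendental over R. *)
Lemma horner_tofracX (R : idomainType) (p : {poly R}) :
  (map_poly (@FracField.tofrac {poly R} \o polyC) p).[FracField.tofrac 'X] =
  FracField.tofrac p.
Proof.
elim/poly_ind: p => [|p a IHp]; first by rewrite !rmorph0 horner0.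
by rewrite !rmorphD !rmorphM /= map_polyX map_polyC hornerMXaddC IHp.
Qed.

Section ParameterRepresentation.
Variables (F : fieldType) (q : F) (hq : q != 0).
Hypothesis q_generic : forall n : nat, (0 < n)%N -> q ^+ n != 1.

Local Notation H := (daha hq).
Local Notation t := (daha_t hq).

Variables (R : idomainType) (iota : {rmorphism F -> R}) (tau : 'I_4 -> R).
Variable e : {rmorphism R -> H}.
Hypothesis e_iota : forall c, e (iota c) = c%:A.
Hypothesis e_tau : forall i, e (tau i) = daha_T hq i.
Hypothesis R_ind : forall B : set R,
  (forall x y, B x -> B y -> B (x + y)) -> (forall x y, B x -> B y -> B (x * y)) ->
  (forall c, B (iota c)) -> (forall i, B (tau i)) -> forall r, B r.

Variables (K : fieldType) (j : {rmorphism R -> K}).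

Let phi : {rmorphism F -> K} := j \o iota.

Lemma e_central r u : GRing.comm (e r) u.
Proof.
move: r u; apply: R_ind => [r s cr cs u|r s cr cs u|c u|i u].
- by rewrite rmorphD; apply/commr_sym/commrD; apply/commr_sym.
- by rewrite rmorphM; apply/commr_sym/commrM; apply/commr_sym.
- by rewrite e_iota /GRing.comm mulr_algl mulr_algr.
by rewrite e_tau; apply: daha_T_central.
Qed.

Lemma parameter_representation (x : K) : x != 0 ->
    (forall m : int, x ^+ 2 != (phi q) ^- 2 ^ m) ->
  exists rho : {rmorphism H -> op K},
  [/\ forall r, rho (e r) = scal (j r), rho (t 0 * t 1) = diag (pt q phi x)
    & forall k, exists m u, (forall i, i.1 = k -> u i = 1) /\
        rho (gen t k) = pair_op k m u].
Proof.
move=> x0 xg.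
have [rho [rho_c rho_T rho_X rho_g]] :=
  @generic_representation F q hq K phi (j \o tau) x x0 q_generic xg.
exists rho; split=> // r; move: r.
apply: R_ind => [r s rE sE|r s rE sE|c|i].
- by rewrite !rmorphD rE sE.
- by rewrite !rmorphM rE sE.
- by rewrite e_iota rho_c.
by rewrite e_tau rho_T.
Qed.

End ParameterRepresentation.

Lemma subalg_closed_setP (F : fieldType) (A : algType F) (B : set A) :
  GRing.subalg_closed (mem B) <->
  [/\ B 1, forall a x y, B x -> B y -> B (a *: x + y)
    & forall x y, B x -> B y -> B (x * y)].
Proof.
split=> -[B1 BZ BM]; split=> [|a x y Bx By|x y Bx By].
- exact: (asboolW B1).
- exact: (asboolW (BZ a x y (asboolT Bx) (asboolT By))).
- exact: (asboolW (BM x y (asboolT Bx) (asboolT By))).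
- exact: (asboolT B1).
- exact: (asboolT (BZ a x y (asboolW Bx) (asboolW By))).
exact: (asboolT (BM x y (asboolW Bx) (asboolW By))).
Qed.

Lemma subalg_gen_closed (F : fieldType) (A : algType F) (S : set A) :
  GRing.subalg_closed (mem (subalg_gen S)).
Proof.
apply/subalg_closed_setP.
split=> [B [/subalg_closed_setP[]//]|a x y Sx Sy B BS|x y Sx Sy B BS].
  have [/subalg_closed_setP[_ BZ _] _] := BS.
  by apply: BZ; [exact: Sx | exact: Sy].
have [/subalg_closed_setP[_ _ BM] _] := BS.
by apply: BM; [exact: Sx | exact: Sy].
Qed.

Lemma center_closed (F : fieldType) (A : algType F) :
  GRing.subalg_closed (mem (@ring_center A)).
Proof.
apply/subalg_closed_setP; split=> [z|a x y cx cy z|x y cx cy z].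
- exact/commr_sym/commr1.
- apply/commr_sym/commrD; last exact/commr_sym.
  by rewrite /GRing.comm -scalerAr -scalerAl cx.
by apply/commr_sym/commrM; apply/commr_sym.
Qed.

Theorem theorem15p9 (F : fieldType) (q : F) (hq0 : q != 0)
    (hq4 : q ^+ 4 != 1)
    (hq : forall n : nat, (0 < n)%N -> q ^+ n != 1) :
  @ring_center (daha hq0) = subalg_gen (range (daha_T hq0)).
Proof.
have Tc (i : nat) u : GRing.comm (daha_T hq0 (inord i)) u by apply: daha_T_central.
have [R [iota [tau [e [e_iota e_tau R_ind]]]]] := free_parameters Tc 4.
have e_tau' (i : 'I_4) : e (tau i) = daha_T hq0 i.
  by rewrite e_tau // inord_val.
have y_free (p : {poly R}) :
    (map_poly (@FracField.tofrac {poly R} \o polyC) p).[FracField.tofrac 'X] = 0 -> p = 0.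
  by rewrite horner_tofracX => /eqP; rewrite tofrac_eq0 => /eqP.
have R_ind' (B : set R) : (forall x y, B x -> B y -> B (x + y)) ->
    (forall x y, B x -> B y -> B (x * y)) ->
    (forall c, B (iota c)) -> (forall i : 'I_4, B (tau i)) -> forall r, B r.
  by move=> BD BM Bi Bt; apply: R_ind => // i i4; apply: (Bt (Ordinal i4)).
apply/seteqP; split=> [z zC|z].
  have e_c := e_central e_iota e_tau' R_ind'.
  have rep := parameter_representation (hq := hq0) hq e_iota e_tau' R_ind'.
  have [r ->] := center_parameters hq0 (daha_tV hq0) (daha_Vt hq0)
    (daha_t_prod hq0) e_iota e_tau' e_c erefl erefl hq (@daha_ind F q hq0) y_free
    (rep _ _) zC.
  have /subalg_closed_setP[S1 SZ SM] := @subalg_gen_closed F _ (range (daha_T hq0)).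
  move: r; apply: R_ind' => [r s rS sS|r s rS sS|c|i].
  - by rewrite rmorphD -[e r]scale1r; apply: SZ.
  - by rewrite rmorphM; apply: SM.
  - have S0 : subalg_gen (range (daha_T hq0)) 0.
      by rewrite -(addNr 1) -scaleN1r; apply: SZ.
    by rewrite e_iota -[c%:A]addr0; apply: SZ.
  by rewrite e_tau' => B [_]; apply; exists i.
apply; split; first exact: center_closed.
by move=> _ [i _ <-]; apply: daha_T_central.
Qed.
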